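(* Let $I,J,K$ be spherical subsets of $S$, and let $u\in R(I,J)$, $v\in R(K,J)$ and $w\in R(I,K)$. There is a non-negative integer $c_{u,v}^w(I,J,K)$ such that $$c_{u,v}^w(I,J,K)=|F(A,J,u)\cap F(B,J,v)|\quad\text{for all } A\in X_I \text{ and all } B\in F(A,K,w).$$ Moreover, for any $z\in W_IwW_K$, $$c_{u,v}^w(I,J,K)=\frac{1}{N(J)}\sum_{x\in W_IuW_J}\ \sum_{y\in W_KvW_J}c_{x,y}^{z}.$$
   Context: Let $(W,S)$ be a Coxeter system with $S$ finite and length function $\ell$. For $I\subseteq S$ let $W_I$ be the subgroup generated by $I$; $I$ is spherical if $W_I$ is finite. For $I,J\subseteq S$, $R(I,J)$ is the set of elements of $W$ that are the minimal-length element of their double coset $W_IwW_J$. Let $X$ be a building of type $(W,S)$ (a simplicial complex with type function $\tau$, chambers of type $S$), chamber set $\mathcal{C}$, Weyl distance $\delta:\mathcal{C}\times\mathcal{C}\to W$. The cotype of a simplex $A$ is $S\setminus\tau(A)$; $X_I$ is the set of cotype-$I$ simplices. $\mathcal{C}(A)$ is the set of chambers containing $A$. For $A\in X_I$, $B\in X_J$, $\delta(A,B)$ is the unique element of $R(I,J)$ in the double coset $\delta(\mathcal{C}(A)\times\mathcal{C}(B))$. $X$ is locally finite and regular: each panel of cotype $\{s\}$ lies in exactly $q_s+1$ chambers. For $w=s_1\cdots s_k$ reduced, $q_w=q_{s_1}\cdots q_{s_k}$, and for spherical $K$, $N(K)=\sum_{v\in W_K}q_v$. For $A\in X_I$ and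 $w\in R(I,J)$, $F(A,J,w)=\{B\in X_J:\delta(A,B)=w\}$. For $c\in\mathcal{C}$ and $x\in W$, $\mathcal{C}_x(c)=\{d\in\mathcal{C}:\delta(c,d)=x\}$. It is known that for $x,y,z\in W$ the number $|\mathcal{C}_x(a)\cap\mathcal{C}_y(b)|$ is the same for all chambers $a,b$ with $\delta(a,b)=z$; this number is denoted $c_{x,y}^z$. *)

(* Defs.v *)
From mathcomp Require Import all_boot all_order all_algebra.
From mathcomp Require Import finmap.
From mathcomp Require Import boolp classical_sets functions cardinality fsbigop.

Set Implicit Arguments.
Unset Strict Implicit.
Unset Printing Implicit Defensive.

Import GRing.Theory.

Local Open Scope fset_scope.
Local Open Scope classical_set_scope.
Local Open Scope card_scope.

(** * Coxeter systems *)

(* An entry equal to 0 encodes the value infinity. *)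
Definition coxeter_matrix (S : finType) (m : S -> S -> nat) : Prop :=
  [/\ forall s, m s s = 1%N,
      forall s t, m s t = m t s
    & forall s t, s != t -> m s t != 1%N].

(* The congruence on words generated by (st)^(m s t) ~ 1. As the relators with
   s = t make every generator its own inverse, the quotient of the free monoid
   on S by this congruence is the group presented by these relators. *)
Inductive coxeter_eq (S : finType) (m : S -> S -> nat) : seq S -> seq S -> Prop :=
| coxeter_eq_refl a : coxeter_eq m a a
| coxeter_eq_sym a b : coxeter_eq m a b -> coxeter_eq m b a
| coxeter_eq_trans a b c :
    coxeter_eq m a b -> coxeter_eq m b c -> coxeter_eq m a c
| coxeter_eq_relator a b s t :
    coxeter_eq m (a ++ flatten (nseq (m s t) [:: s; t]) ++ b) (a ++ b).

Section Coxeter.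
Variables (W : groupType) (S : finType) (gen : S -> W).

Definition word (a : seq S) : W := (\prod_(s <- a) gen s)%g.

(* S is identified with a subset of W by the injection gen, and W has the
   presentation < S | (st)^(m s t) = 1 if m s t is finite >. *)
Definition coxeter_system : Prop :=
  injective gen /\
  exists m : S -> S -> nat,
    [/\ coxeter_matrix m,
        forall w : W, exists a, word a = w
      & forall a b, word a = word b <-> coxeter_eq m a b].

Definition reduced (a : seq S) : Prop :=
  forall b, word b = word a -> (size a <= size b)%N.

(* A chosen reduced expression of w. *)
Definition redword (w : W) : seq S :=
  xget [::] [set a | word a = w /\ reduced a].

Definition ell (w : W) : nat := size (redword w).

Definition is_subgroup (H : set W) : Prop :=
  [/\ H 1%g, forall x y, H x -> H y -> H (x * y)%g & forall x, H x -> H x^-1%g].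

Definition parabolic (I : {set S}) : set W :=
  smallest is_subgroup [set gen s | s in [set` I]].

Definition spherical (I : {set S}) : Prop := finite_set (parabolic I).

Definition dcoset (I : {set S}) (w : W) (J : {set S}) : set W :=
  [set (x * w * y)%g | x in parabolic I & y in parabolic J].

Definition min_reps (I J : {set S}) : set W :=
  [set w | forall x, dcoset I w J x -> (ell w <= ell x)%N].

(* The value does not depend on the reduced expression when q is the parameter
   family of a regular building. *)
Definition q_ (q : S -> nat) (w : W) : nat := (\prod_(s <- redword w) q s)%N.

Definition Npar (q : S -> nat) (K : {set S}) : nat :=
  (\sum_(v \in parabolic K) q_ q v)%R.

End Coxeter.

(** * Simplicial complexes *)

(* A complex is given by its set of simplices, the empty simplex included. *)
Definition simplicial_complex (V : choiceType) (X : set {fset V}) : Prop :=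
  X fset0 /\ forall A B : {fset V}, X A -> (B `<=` A)%fset -> X B.

Definition vertex (V : choiceType) (X : set {fset V}) : set V :=
  [set v | X [fset v]].

Definition complex_iso (V V' : choiceType) (f : V -> V')
    (X : set {fset V}) (X' : set {fset V'}) : Prop :=
  {in vertex X &, injective f} /\
  [set [fset f v | v in A] | A in X] = X'.

Definition maximal_simplex (V : choiceType) (X : set {fset V}) (A : {fset V}) :=
  X A /\ forall B, X B -> (A `<=` B)%fset -> B = A.

Section Typed.
Variables (V : choiceType) (S : finType) (tau : V -> S).

Definition simplex_type (A : {fset V}) : {set S} :=
  finset (fun s => s \in [seq tau v | v <- A]).

Definition cotype (A : {fset V}) : {set S} := (~: simplex_type A)%SET.

Definition type_function (X : set {fset V}) : Prop :=
  forall C, maximal_simplex X C ->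
    {in C &, injective tau} /\ simplex_type C = [set: S]%SET.

End Typed.

(* The Coxeter complex Sigma(W,S). Its vertices are the maximal proper standard
   cosets w W_(S - {s}), tagged with their type s; the standard coset w W_(S - T)
   is the simplex with vertices w W_(S - {s}) for s in T. *)
Definition coxeter_vertex (W : groupType) (S : finType) (gen : S -> W)
    (w : W) (s : S) : S * set W :=
  (s, [set (w * x)%g | x in parabolic gen (~: [set s])%SET]).

Definition coxeter_complex (W : groupType) (S : finType) (gen : S -> W) :
    set {fset (S * set W)} :=
  [set A | exists w (T : {set S}),
      A = [fset coxeter_vertex gen w s | s in T]].

(** * Buildings *)

Section Building.
Variables (W : groupType) (S : finType) (gen : S -> W).
Variables (V : choiceType) (X : set {fset V}) (tau : V -> S).

Record apartment_system (apts : set (set {fset V})) : Prop := {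
  apt_sub : forall Y, apts Y -> Y `<=` X;
  apt_cover : forall A, X A -> exists2 Y, apts Y & Y A;
  apt_coxeter : forall Y, apts Y -> exists f : S * set W -> V,
    complex_iso f (coxeter_complex gen) Y /\
    forall x, vertex (coxeter_complex gen) x -> tau (f x) = x.1;
  apt_common : forall A B, X A -> X B -> exists Y, [/\ apts Y, Y A & Y B];
  apt_iso : forall Y Y' A B, apts Y -> apts Y' ->
    Y A -> Y B -> Y' A -> Y' B ->
    exists f : V -> V, complex_iso f Y Y' /\
      forall v, v \in (A `|` B)%fset -> f v = v
}.

Definition building : Prop :=
  [/\ simplicial_complex X, type_function tau X
    & exists apts, apartment_system apts].

Definition chamber : set {fset V} := [set C | maximal_simplex X C].

Definition simplices (I : {set S}) : set {fset V} :=
  [set A | X A /\ cotype tau A = I].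

Definition chambers_of (A : {fset V}) : set {fset V} :=
  [set C | chamber C /\ (A `<=` C)%fset].

Definition regular (q : S -> nat) : Prop :=
  forall s P, simplices [set s]%SET P -> chambers_of P #= `I_(q s).+1.

Definition adjacent (s : S) (C D : {fset V}) : Prop :=
  C <> D /\
  exists P, [/\ simplices [set s]%SET P, chambers_of P C & chambers_of P D].

Fixpoint gallery (C : {fset V}) (a : seq S) (D : {fset V}) : Prop :=
  if a is s :: a' then exists2 E, adjacent s C E & gallery E a' D else C = D.

Definition minimal_gallery_type (C D : {fset V}) (a : seq S) : Prop :=
  gallery C a D /\ forall b, gallery C b D -> (size a <= size b)%N.

(* The Weyl distance between chambers: the product of the type of a minimal
   gallery from C to D. *)
Definition delta (C D : {fset V}) : W :=
  xget 1%g [set word gen a | a in minimal_gallery_type C D].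

Definition delta_simplex (A B : {fset V}) : W :=
  xget 1%g (min_reps gen (cotype tau A) (cotype tau B) `&`
            [set delta C D | C in chambers_of A & D in chambers_of B]).

Definition F_ (A : {fset V}) (J : {set S}) (w : W) : set {fset V} :=
  [set B | simplices J B /\ delta_simplex A B = w].

Definition sphere (x : W) (C : {fset V}) : set {fset V} :=
  [set D | chamber D /\ delta C D = x].

(* The common cardinality c_{x,y}^z of the sets C_x(a) `&` C_y(b), where a and b
   are chambers with delta a b = z. *)
Definition structure_const (x y z : W) : nat :=
  xget 0%N [set n : nat | forall a b, chamber a -> chamber b -> delta a b = z ->
    sphere x a `&` sphere y b #= `I_n].

End Building.

(* Main.v *)
(* For chambers a, b containing A, B with delta(a,b) = z, the simplices in the
   intersection are the cotype-J faces of the chambers d with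
   delta(a,d) in W_I u W_J and delta(b,d) in W_K v W_J. Each of them lies in N(J)
   such chambers, and the chambers d are counted by the c_(x,y)^z; the number so
   obtained does not depend on (A, B), and z is arbitrary in W_I w W_K because
   delta(C(A) x C(B)) is a full double coset.

   The Weyl distance is read off in any apartment containing both chambers: an
   isomorphism of apartments fixing a chamber is rigid, so the choice of the
   apartment is irrelevant. If delta(C,D) = w and D' is s-adjacent to D, then
   delta(C,D') is w or ws, and it is ws when l(ws) > l(w). Hence spheres around C
   are built up one letter at a time, which gives both their cardinalities and the
   constants c_(x,y)^z. On the group side one needs the deletion condition, obtained
   from the presentation by counting modulo 2 how often a reflection occurs along a
   word. *)
Require Import Defs.
From mathcomp Require Import all_boot all_order all_algebra.
From mathcomp Require Import finmap.
From mathcomp Require Import boolp classical_sets functions cardinality fsbigop.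

Local Open Scope classical_set_scope.
Local Open Scope card_scope.
Set Implicit Arguments.
Unset Strict Implicit.
Unset Printing Implicit Defensive.

(** * Subsequences *)

Lemma subseq_catP (T : eqType) (c a b : seq T) : subseq c (a ++ b) ->
  exists c1 c2, [/\ c = c1 ++ c2, subseq c1 a & subseq c2 b].
Proof.
elim: a c => [|x a IH] c /=; first by exists [::], c; rewrite eqxx.
case: c => [_|y c]; first by exists [::], [::]; rewrite !sub0seq.
case: ifP => [/eqP-> | yx] /IH [c1 [c2 [def_c sub1 sub2]]].
  by exists (x :: c1), c2; rewrite /= eqxx def_c.
exists c1, c2; split=> //; exact: (subseq_trans sub1 (subseq_cons _ _)).
Qed.

Lemma subseq_size_eq (T : eqType) (a b : seq T) :
  subseq a b -> size b <= size a -> a = b.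
Proof. by move=> ab sz; apply/eqP; rewrite -(size_subseq_leqif ab) eqn_leq size_subseq. Qed.

(** * Words in a Coxeter group *)

Section Words.
Local Open Scope group_scope.
Variables (W : groupType) (S : finType) (gen : S -> W).
Notation word := (word gen).
Notation reduced := (reduced gen).
Notation ell := (ell gen).
Notation parabolic := (parabolic gen).

Lemma word_nil : word [::] = 1.
Proof. exact: big_nil. Qed.

Lemma word_cons s a : word (s :: a) = gen s * word a.
Proof. exact: big_cons. Qed.

Lemma word1 s : word [:: s] = gen s.
Proof. by rewrite word_cons word_nil mulg1. Qed.

Lemma word_cat a b : word (a ++ b) = word a * word b.
Proof. exact: big_cat. Qed.

Lemma word_flatten_nseq n a : word (flatten (nseq n a)) = word a ^+ n.
Proof.
by elim: n => [|n IH]; rewrite /= ?word_nil // word_cat IH expgS.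
Qed.

Lemma parabolic_subgroup I : is_subgroup (parabolic I).
Proof.
split=> [H [[]] // | x y Hx Hy H HI | x Hx H HI].
  by case: (HI) => -[_ + _] _; apply; [apply: Hx | apply: Hy].
by case: (HI) => -[_ _ +] _; apply; apply: Hx.
Qed.

Lemma parabolic1 I : parabolic I 1.
Proof. by case: (parabolic_subgroup I). Qed.

Lemma parabolicM I x y : parabolic I x -> parabolic I y -> parabolic I (x * y).
Proof. by case: (parabolic_subgroup I) => _ + _; apply. Qed.

Lemma parabolicV I x : parabolic I x -> parabolic I x^-1.
Proof. by case: (parabolic_subgroup I) => _ _; apply. Qed.

Lemma parabolic_gen (I : {set S}) s : s \in I -> parabolic I (gen s).
Proof. by move=> sI H [_]; apply; exists s. Qed.

Lemma parabolic_word (I : {set S}) a :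
  all [in I] a -> parabolic I (word a).
Proof.
elim: a => [|s a IH] /=; first by rewrite word_nil => _; apply: parabolic1.
by case/andP=> sI aI; rewrite word_cons; apply: parabolicM (parabolic_gen sI) (IH aI).
Qed.

Lemma reduced_cons s a : reduced (s :: a) -> reduced a.
Proof.
move=> red b wb; have := red (s :: b); rewrite !word_cons wb => /(_ erefl).
by [].
Qed.

Lemma dcoset_refl I w J : dcoset gen I w J w.
Proof.
by exists 1; [exact: parabolic1|exists 1; [exact: parabolic1|rewrite mul1g mulg1]].
Qed.

Lemma dcoset_trans I x y z J :
  dcoset gen I x J y -> dcoset gen I y J z -> dcoset gen I x J z.
Proof.
case=> a Ia [b Jb <-] [a' Ia' [b' Jb' <-]].
exists (a' * a); first exact: parabolicM.
by exists (b * b'); [exact: parabolicM | rewrite !mulgA].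
Qed.

Lemma dcoset_sym I x y J : dcoset gen I x J y -> dcoset gen I y J x.
Proof.
case=> a Ia [b Jb <-]; exists a^-1; first exact: parabolicV.
by exists b^-1; [exact: parabolicV | rewrite -!mulgA mulKg mulgV mulg1].
Qed.

Lemma dcoset_eq I x y J : dcoset gen I x J y -> dcoset gen I y J = dcoset gen I x J.
Proof.
move=> xy; apply/seteqP; split=> z; first exact: dcoset_trans.
by apply: dcoset_trans; apply: dcoset_sym.
Qed.

(* The reflections s1 .. s_(i-1) s_i s_(i-1) .. s1 attached to s1 .. sn. *)
Fixpoint reflections (a : seq S) : seq W :=
  if a is s :: a' then
    gen s :: [seq gen s * r * (gen s)^-1 | r <- reflections a']
  else [::].

Lemma size_reflections a : size (reflections a) = size a.
Proof. by elim: a => //= s a IH; rewrite size_map IH. Qed.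

Lemma reflections_cat a b : reflections (a ++ b) =
  reflections a ++ [seq word a * r * (word a)^-1 | r <- reflections b].
Proof.
elim: a => [|s a IH] /=.
  rewrite -[LHS]map_id; apply: eq_map => r.
  by rewrite word_nil mul1g invg1 mulg1.
rewrite IH map_cat -map_comp; congr (_ :: _ ++ _); apply: eq_map => r /=.
by rewrite word_cons invgM !mulgA.
Qed.

Lemma mem_reflections t a : t \in reflections a ->
  exists b s c, a = b ++ s :: c /\ t = word b * gen s * (word b)^-1.
Proof.
elim: a t => //= s a IH t; rewrite inE => /predU1P[->|].
  by exists [::], s, a; rewrite word_nil mul1g invg1 mulg1.
case/mapP=> r /IH [b [s' [c [-> ->]]]] ->; exists (s :: b), s', c; split=> //.
by rewrite word_cons invgM !mulgA.
Qed.

Hypothesis cox : coxeter_system gen.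

Lemma gen_inj : injective gen.
Proof. by case: cox. Qed.

(** The relator for the pair [s], [s] has exponent 1, so it is the word [s s]. *)
Lemma genK s : gen s * gen s = 1.
Proof.
case: cox => _ [m [[mss _ _] _ /(_ ([:: s; s] ++ [::]) [::])]].
rewrite cats0 !word_cons word_nil mulg1 => -[_]; apply.
by have := coxeter_eq_relator m [::] [::] s s; rewrite mss.
Qed.

Lemma genV s : (gen s)^-1 = gen s.
Proof. exact/mulg1_eq/genK. Qed.

Lemma wordP w : exists a, word a = w.
Proof. by case: cox => _ [m [_ + _]]; apply. Qed.

Lemma word_rev a : word (rev a) = (word a)^-1.
Proof.
elim: a => [|s a IH]; first by rewrite word_nil invg1.
by rewrite rev_cons -cats1 word_cat IH word1 word_cons invgM genV.
Qed.

(** Every relator has even length. *)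
Lemma odd_size_word a b : word a = word b -> odd (size a) = odd (size b).
Proof.
case: cox => _ [m [_ _ pres]] /pres; elim=> // [? ? ? _ -> _ -> //|c d s t].
rewrite !size_cat !oddD; suff ->: odd (size (flatten (nseq (m s t) [:: s; t]))) = false by [].
by elim: (m s t) => //= n ->.
Qed.

(** The i-th reflection of the alternating word is (st)^i s, so the list has period m once (st)^m =
    1. *)
Lemma reflections_dihedral n s t : reflections (flatten (nseq n [:: s; t])) =
  [seq (gen s * gen t) ^+ i * gen s | i <- iota 0 n.*2].
Proof.
elim: n => //= n ->; rewrite expg0 mul1g expg1 genV; congr [:: _, _ & _].
rewrite (iotaDl 2 0) -!map_comp; apply: eq_map => i /=.
by rewrite genV -[2 + i]/i.+2 expgS expgSr !mulgA.
Qed.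

(* In the word (st)^m the reflections i and i + m coincide. *)
Lemma odd_count_reflections t a b : word a = word b ->
  odd (count_mem t (reflections a)) = odd (count_mem t (reflections b)).
Proof.
case: cox => _ [m [_ _ pres]] /pres ab.
elim: ab => // [? ? ? _ -> _ -> //|{}a {}b s s'].
set r := flatten _; have wr : word r = 1.
  rewrite -word_nil; apply/pres.
  by have := coxeter_eq_relator m [::] [::] s s'; rewrite cats0.
have conj1 l : [seq 1 * x * 1^-1 | x <- l] = l :> seq W.
  by rewrite -[RHS]map_id; apply: eq_map => x; rewrite mul1g invg1 mulg1.
rewrite !reflections_cat wr conj1 map_cat !count_cat !oddD.
congr (_ (+) _); rewrite -[RHS]addFb; congr (_ (+) _).
have gm : (gen s * gen s') ^+ m s s' = 1.
  by rewrite -wr word_flatten_nseq !word_cons word_nil mulg1.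
rewrite reflections_dihedral -addnn iotaD addnC iotaDl !map_cat count_cat oddD.
rewrite -[X in _ (+) odd (count _ (map _ X))]map_comp.
rewrite [X in _ (+) odd (count _ (map _ X))](_ : _ =
  [seq (gen s * gen s') ^+ i * gen s | i <- iota 0 (m s s')]) ?addbb //.
by apply: eq_map => i /=; rewrite expgnDr gm mul1g.
Qed.

(** The deletion step. If the first reflection [gen s] recurs, then [s b = b s'] in the group for a
    stretch [b] of the word, and the letters [s] and [s'] cancel. Any other repetition already
    occurs in the tail, conjugation being injective. *)
Lemma not_uniq_reflections a : ~~ uniq (reflections a) ->
  exists b, [/\ subseq b a, size b < size a & word b = word a].
Proof.
elim: a => //= s a IH; rewrite negb_and negbK => /orP[/mapP[r ra gs]|].
  have {ra gs} : gen s \in reflections a.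
    suff -> : gen s = r by [].
    move: gs; rewrite -mulgA => /(canLR (mulKg _)); rewrite mulVg.
    by move/esym/divg1_eq ->.
  case/mem_reflections=> b [s' [c [-> gs]]]; exists (b ++ c).
  rewrite !size_cat /= addnS ltnS leqnSn; split=> //.
    by apply: (subseq_trans _ (subseq_cons _ _)); rewrite cat_subseq ?subseq_cons.
  rewrite word_cons !word_cat word_cons gs !mulgA mulgVK -[_ * gen s' * gen s']mulgA.
  by rewrite genK mulg1.
rewrite map_inj_uniq => [/IH [b [ba sz wb]]|x y /mulIg /mulgI //].
by exists (s :: b); rewrite /= eqxx !word_cons wb.
Qed.

(** For the converse, a reflection listed once for [a] is listed an odd number of times, hence at
    least once, for any [b] with the same value; so [b] has at least as many letters. *)
Lemma uniq_reflections a : reduced a <-> uniq (reflections a).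
Proof.
split=> [red|ua b wba].
  by apply/negPn/negP => /not_uniq_reflections [b [_ + /red]]; rewrite ltnNge => /negP.
rewrite -!size_reflections uniq_leq_size // => t ta.
have := odd_count_reflections t wba.
rewrite (count_uniq_mem _ ua) ta => odd_t.
by rewrite -has_pred1 has_count lt0n; apply: contraL odd_t => /eqP ->.
Qed.

Lemma reduced_subword a : exists b, [/\ subseq b a, reduced b & word b = word a].
Proof.
have [n] := ubnP (size a); elim: n a => // n IH a; rewrite ltnS => sz.
case: (boolP (uniq (reflections a))) => [/uniq_reflections|/not_uniq_reflections].
  by exists a.
case=> b [sub_b lt_b wb]; have [|c [sub_c red_c wc]] := IH b.
  exact: leq_trans lt_b sz.
by exists c; split; rewrite ?wc // (subseq_trans sub_c).
Qed.

(** * The length function *)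

Lemma redwordP w : word (redword gen w) = w /\ reduced (redword gen w).
Proof.
apply: (@xgetPex _ [::] [set a | word a = w /\ reduced a]).
by have [a <-] := wordP w; have [b [_ red_b <-]] := reduced_subword a; exists b.
Qed.

Lemma word_redword w : word (redword gen w) = w.
Proof. by case: (redwordP w). Qed.

Lemma reduced_redword w : reduced (redword gen w).
Proof. by case: (redwordP w). Qed.

Lemma ell_word_le a : ell (word a) <= size a.
Proof. by apply: reduced_redword; rewrite word_redword. Qed.

Lemma ell_word a : reduced a -> ell (word a) = size a.
Proof.
move=> red_a; apply/eqP; rewrite eqn_leq ell_word_le /=.
by apply: red_a; rewrite word_redword.
Qed.

Lemma ellV_le w : ell w^-1 <= ell w.
Proof. by rewrite -{1}[w]word_redword -word_rev (leq_trans (ell_word_le _)) ?size_rev. Qed.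

Lemma ellV w : ell w^-1 = ell w.
Proof. by apply/eqP; rewrite eqn_leq ellV_le -{1}[w]invgK ellV_le. Qed.

Lemma ellM_le w1 w2 : ell (w1 * w2) <= ell w1 + ell w2.
Proof.
by rewrite -{1}[w1]word_redword -{1}[w2]word_redword -word_cat -size_cat ell_word_le.
Qed.

Lemma ell_gen_le s : ell (gen s) <= 1.
Proof. by rewrite -word1 ell_word_le. Qed.

Lemma odd_ell a : odd (ell (word a)) = odd (size a).
Proof. by apply: odd_size_word; rewrite word_redword. Qed.

Lemma odd_ell_gen w s : odd (ell (w * gen s)) = ~~ odd (ell w).
Proof.
have [a <-] := wordP w; rewrite -word1 -word_cat !odd_ell size_cat addn1.
by [].
Qed.

Lemma gen_neq1 s : gen s <> 1.
Proof.
move=> gs; have := odd_ell_gen 1 s.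
by rewrite gs mulg1; case: odd.
Qed.

Lemma ell_gen_neq w s : ell (w * gen s) != ell w.
Proof. by apply/eqP => e; have := odd_ell_gen w s; rewrite e; case: odd. Qed.

(** * Parabolic subgroups and minimal double coset representatives *)

Lemma parabolicP (I : {set S}) w : parabolic I w -> 
  exists a, all [in I] a /\ word a = w.
Proof.
move=> Iw; pose H := [set w | exists a, all [in I] a /\ word a = w].
apply: (Iw H); split=> [|_ [s sI <-]]; last by exists [:: s]; rewrite word1 /= andbT.
split=> [|x y [a [aI <-]] [b [bI <-]]|x [a [aI <-]]].
- by exists [::]; rewrite word_nil.
- by exists (a ++ b); rewrite word_cat all_cat aI bI.
by exists (rev a); rewrite word_rev all_rev.
Qed.

Lemma parabolic_reduced (I : {set S}) w : parabolic I w ->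
  exists a, [/\ all [in I] a, reduced a & word a = w].
Proof.
case/parabolicP=> a [aI <-]; have [b [sub_b red_b wb]] := reduced_subword a.
by exists b; split=> //; apply/allP => s /(mem_subseq sub_b) /(allP aI).
Qed.

Lemma parabolic_genE (I : {set S}) s : parabolic I (gen s) -> s \in I.
Proof.
case/parabolic_reduced=> [[|s1 [|s2 b]] [bI red_b wb]].
- by case: (@gen_neq1 s); rewrite -wb word_nil.
- by move: wb; rewrite word1 => /gen_inj <-; case/andP: bI.
by have := ell_gen_le s; rewrite -wb ell_word.
Qed.

(* The first letter of a reduced word is one of its reflections, hence also a
   reflection of any word in I with the same value. *)
Lemma parabolic_letters (I : {set S}) a :
  reduced a -> parabolic I (word a) -> all [in I] a.
Proof.
elim: a => //= s a IH red_sa Isa; suff sI : s \in I.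
  rewrite sI IH //; first exact: reduced_cons red_sa.
  rewrite -[word a](mulKg (gen s)) -word_cons genV.
  by apply: parabolicM Isa; apply: parabolic_gen.
apply: parabolic_genE; have [b [bI wb]] := parabolicP Isa.
have : gen s \in reflections b.
  have /uniq_reflections u := red_sa.
  have := odd_count_reflections (gen s) wb.
  rewrite (count_uniq_mem _ u) /= mem_head => odd_s.
  by rewrite -has_pred1 has_count lt0n; apply: contraL odd_s => /eqP ->.
case/mem_reflections=> c [s' [d [def_b ->]]]; move: bI.
rewrite def_b all_cat /= => /and3P[/parabolic_word cI s'I _].
by do ![apply: parabolicM] => //; [exact: parabolic_gen | exact: parabolicV].
Qed.

(** A reduced word of an element of all these maximal parabolics avoids every letter outside [I].
    Each vertex of a chamber records a coset of one maximal parabolic, so this is how faces see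
    general ones. *)
Lemma parabolic_bigcap (I : {set S}) w :
  parabolic I w <-> forall s, s \notin I -> parabolic (~: [set s])%SET w.
Proof.
split=> [/parabolicP [a [aI <-]] s sI|Iw].
  apply: parabolic_word; apply/allP => t /(allP aI) tI; rewrite !inE.
  by apply: contra sI => /eqP <-.
rewrite -[w]word_redword; apply: parabolic_word; apply/allP => s sw.
apply: contraLR (sw) => /Iw; rewrite -{1}[w]word_redword.
move=> /(parabolic_letters (@reduced_redword w)) /allP /(_ s) Is.
by apply/negP => /Is; rewrite !inE eqxx.
Qed.

Lemma parabolic0 w : parabolic finset.set0 w -> w = 1.
Proof. by case/parabolicP=> -[|s a] [] /=; rewrite ?word_nil ?inE. Qed.

Lemma parabolic_set1 s w : parabolic [set s]%SET w -> w = 1 \/ w = gen s.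
Proof.
case/parabolicP=> a [] + <-; elim: a => [|t a IH] /=; first by rewrite word_nil; left.
rewrite inE word_cons => /andP[/eqP -> /IH [->|->]]; rewrite ?genK ?mulg1;
  by [left | right].
Qed.

(* Deleting letters from a product of reduced words for x, w and y cannot touch
   the minimal representative w. *)
Lemma min_reps_reduced (I J : {set S}) w z : min_reps gen I J w ->
  dcoset gen I w J z -> exists x y, z = x * w * y /\ ell z = ell x + ell w + ell y.
Proof.
move=> min_w [x Ix [y Jy def_z]].
have [a [aI red_a wa]] := parabolic_reduced Ix.
have [b [bJ red_b wb]] := parabolic_reduced Jy.
have [c [sub_c red_c wc]] := reduced_subword (a ++ redword gen w ++ b).
have [c1 [c' [def_c sub1 /subseq_catP [c2 [c3 [def_c' sub2 sub3]]]]]] := subseq_catP sub_c.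
have c1I : parabolic I (word c1).
  by apply: parabolic_word; apply/allP => s /(mem_subseq sub1) /(allP aI).
have c3J : parabolic J (word c3).
  by apply: parabolic_word; apply/allP => s /(mem_subseq sub3) /(allP bJ).
have wz : z = word c1 * word c2 * word c3.
  by rewrite -def_z -wa -wb -{1}[w]word_redword -!word_cat -catA -wc def_c def_c' catA.
have def_c2 : c2 = redword gen w.
  apply: subseq_size_eq => //; apply: leq_trans (ell_word_le c2); apply: min_w.
  apply: (@dcoset_trans I w z); first by exists x => //; exists y.
  exists (word c1)^-1; first exact: parabolicV.
  exists (word c3)^-1; first exact: parabolicV.
  by rewrite wz !mulgA mulVg mul1g mulgK.
exists (word c1), (word c3); split; first by rewrite wz def_c2 word_redword.
have def_wc : z = word c by rewrite wz -!word_cat def_c def_c' catA.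
move: (red_c); rewrite def_wc => /ell_word ->.
apply/eqP; rewrite eqn_leq; apply/andP; split; last first.
  by rewrite def_c def_c' !size_cat addnA !leq_add ?ell_word_le // def_c2.
rewrite -(ell_word red_c) -def_wc wz def_c2 word_redword.
by apply: (leq_trans (ellM_le _ _)); rewrite leq_add2r ellM_le.
Qed.

Lemma ell0 w : ell w = 0%N -> w = 1.
Proof. by move/size0nil => e; rewrite -[w]word_redword e word_nil. Qed.

(** Additivity of lengths in [min_reps_reduced] and minimality of [w'] force both outer factors to
    have length 0. *)
Lemma min_reps_unique (I J : {set S}) w w' : min_reps gen I J w ->
  min_reps gen I J w' -> dcoset gen I w J w' -> w' = w.
Proof.
move=> min_w min_w' ww'; have [x [y [def_w' exy]]] := min_reps_reduced min_w ww'; rewrite def_w'.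
have := min_w' _ (dcoset_sym ww'); rewrite exy addnAC -[X in _ <= X]add0n.
rewrite leq_add2r leqn0 addn_eq0 => /andP[/eqP /ell0 -> /eqP /ell0 ->].
by rewrite mul1g mulg1.
Qed.

Lemma min_reps_exists (I J : {set S}) w :
  exists2 x, dcoset gen I w J x & min_reps gen I J x.
Proof.
have [n] := ubnP (ell w); elim: n w => // n IH w; rewrite ltnS => le_n.
case: (pselect (min_reps gen I J w)) => [min_w|]; first by exists w => //; exact: dcoset_refl.
move/existsNP=> [x /not_implyP [wx /negP]]; rewrite -ltnNge => lt_x.
by have [|y xy min_y] := IH x; [exact: leq_trans lt_x le_n | exists y => //; apply: dcoset_trans xy].
Qed.

Lemma q_1 q : q_ gen q 1 = 1%N.
Proof.
rewrite /q_; suff -> : redword gen 1 = [::] by rewrite big_nil.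
by apply/size0nil/eqP; rewrite -leqn0; have := ell_word_le [::]; rewrite word_nil.
Qed.

End Words.

(** * Cardinality of disjoint unions *)

(** Finiteness has to be said, since [fset_set] sends infinite sets to the empty one. *)
Lemma card_fset_setP (T : choiceType) (A : set T) n :
  A #= `I_n <-> finite_set A /\ #|` fset_set A| = n.
Proof.
split=> [An|[finA <-]]; first by split; [apply/finite_setP; exists n | exact: card_fset_set].
by rewrite -{1}(fset_setK finA); apply/card_eq_fsetP.
Qed.

Lemma card_setU_disj (T : choiceType) (A B : set T) m n :
  A #= `I_m -> B #= `I_n -> A `&` B = set0 -> A `|` B #= `I_(m + n).
Proof.
move=> /card_fset_setP [finA <-] /card_fset_setP [finB <-] AB0.
apply/card_fset_setP; split; first by rewrite finite_setU.
by rewrite fset_setU // cardfsU -fset_setI // AB0 fset_set0 cardfs0 subn0.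
Qed.

Lemma card_bigcup (T U : choiceType) (A : set T) (B : T -> set U) (n : T -> nat) :
  finite_set A -> (forall i, A i -> B i #= `I_(n i)) -> trivIset A B ->
  \bigcup_(i in A) B i #= `I_(\sum_(i <- fset_set A) n i).
Proof.
move=> finA Bn trivB.
suff gen (l : seq T) : uniq l -> [set` l] `<=` A ->
    \bigcup_(i in [set` l]) B i #= `I_(\sum_(i <- l) n i).
  have := gen _ (fset_uniq (fset_set A)); rewrite fset_setK //; exact.
elim: l => [|x l IH] /=.
  by move=> _ _; rewrite big_nil set_nil bigcup_set0 II0 card_eq00.
case/andP=> xl ul lA; have def_l : [set` x :: l] = x |` [set` l].
  apply/seteqP; split=> y /=; first by rewrite inE => /predU1P.
  by case=> [->|yl]; rewrite /= inE ?eqxx ?yl ?orbT.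
have Ax : A x by apply: lA; rewrite /= mem_head.
have lA' : [set` l] `<=` A by move=> y yl; apply: lA; rewrite /= inE [y \in l]yl orbT.
rewrite def_l bigcup_setU1 big_cons; apply: card_setU_disj; [exact: Bn|exact: IH|].
apply/seteqP; split=> // u [Bxu [y /= yl Byu]].
have exy : x = y by apply: trivB => //; [exact: lA' | exists u].
by rewrite exy yl in xl.
Qed.

Lemma card_bigcup_const (T U : choiceType) (A : set T) (B : T -> set U) m n :
  A #= `I_m -> (forall i, A i -> B i #= `I_n) -> trivIset A B ->
  \bigcup_(i in A) B i #= `I_(m * n).
Proof.
move=> /card_fset_setP [finA <-] Bn /(card_bigcup finA Bn).
by rewrite big_const_seq count_predT iter_addn_0 mulnC.
Qed.

(** * Apartments *)

Section Charts.
Local Open Scope group_scope.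
Variables (W : groupType) (S : finType) (gen : S -> W).
Variables (V : choiceType) (tau : V -> S).

Definition face (c : W -> S -> V) (w : W) (T : {set S}) : {fset V} :=
  [fset c w s | s in T]%fset.

(* An isomorphism of the Coxeter complex with Y, seen as a labelling: c w s is
   the vertex of type s of the chamber w. *)
Record chart (Y : set {fset V}) (c : W -> S -> V) : Prop := Chart {
  chart_type : forall w s, tau (c w s) = s;
  chart_eq : forall w w' s,
    c w s = c w' s <-> parabolic gen (~: [set s])%SET (w^-1 * w');
  chart_face : forall A, Y A <-> exists w T, A = face c w T
}.

Lemma mem_face c w (T : {set S}) s : s \in T -> c w s \in face c w T.
Proof. by move=> sT; apply/imfsetP; exists s. Qed.

Lemma coxeter_vertex_eq w w' s :
  coxeter_vertex gen w s = coxeter_vertex gen w' s <->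
  parabolic gen (~: [set s])%SET (w^-1 * w').
Proof.
split=> [[] /seteqP [_ /(_ w')] | ww'].
  case; first by exists 1; [exact: parabolic1 | rewrite mulg1].
  by move=> x Px <-; rewrite mulKg.
congr (_, _); apply/seteqP; split=> _ [x Px <-].
  exists (w'^-1 * w * x); last by rewrite !mulgA mulgV mul1g.
  apply: parabolicM Px; rewrite -[w in _ * w]invgK -invgM; exact: parabolicV.
exists (w^-1 * w' * x); last by rewrite !mulgA mulgV mul1g.
exact: parabolicM.
Qed.

Lemma complex_iso_chart Y (f : S * set W -> V) :
  complex_iso f (coxeter_complex gen) Y ->
  (forall x, vertex (coxeter_complex gen) x -> tau (f x) = x.1) ->
  chart Y (fun w s => f (coxeter_vertex gen w s)).
Proof.
move=> [f_inj f_im] f_type.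
have vtx w s : vertex (coxeter_complex gen) (coxeter_vertex gen w s).
  exists w, [set s]%SET; apply/fsetP => v; rewrite inE.
  apply/eqP/imfsetP => [->|[t /= /finset.set1P -> //]].
  by exists s => //=; rewrite inE.
split=> [w s|w w' s|A]; first exact: f_type.
  rewrite -coxeter_vertex_eq; split=> [|-> //].
  by apply: f_inj; apply: mem_set.
have faceE w (T : {set S}) : [fset f v | v in [fset coxeter_vertex gen w s | s in T]]%fset =
    face (fun w s => f (coxeter_vertex gen w s)) w T.
  apply/fsetP => v; apply/imfsetP/imfsetP => /= [[_ /imfsetP [s sT ->] ->]|[s sT ->]].
    by exists s.
  by exists (coxeter_vertex gen w s) => //; apply/imfsetP; exists s.
rewrite -f_im; split=> [[_ [w [T ->]] <-]|[w [T ->]]].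
  by exists w, T; rewrite faceE.
by exists [fset coxeter_vertex gen w s | s in T]%fset; [exists w, T | rewrite faceE].
Qed.

(** Left translations are automorphisms of the Coxeter complex; they let any chamber of an apartment
    carry the label 1. *)
Lemma chart_shift Y c g : chart Y c -> chart Y (fun w => c (g * w)).
Proof.
case=> c_type c_eq c_face; split=> [w s|w w' s|A]; first exact: c_type.
  by rewrite c_eq invgM -mulgA mulKg.
rewrite c_face; split=> -[w [T ->]]; last by exists (g * w), T.
by exists (g^-1 * w), T; rewrite /face mulVKg.
Qed.

Section OneChart.
Variables (Y : set {fset V}) (c : W -> S -> V).
Hypothesis chart_c : chart Y c.

Lemma chart_vertex w s : vertex Y (c w s).
Proof.
apply/(chart_face chart_c); exists w, [set s]%SET; apply/fsetP => v; rewrite inE.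
apply/eqP/imfsetP => [->|[t /= /finset.set1P -> //]].
by exists s => //=; rewrite inE.
Qed.

Lemma chart_inj w w' s s' : c w s = c w' s' -> s = s'.
Proof. by move/(congr1 tau); rewrite !(chart_type chart_c). Qed.

Lemma face_in w T : Y (face c w T).
Proof. by apply/(chart_face chart_c); exists w, T. Qed.

Lemma simplex_type_face w T : simplex_type tau (face c w T) = T.
Proof.
apply/setP => s; rewrite inE; apply/mapP/idP => [[v /imfsetP [t /= tT ->] ->]|sT].
  by rewrite (chart_type chart_c).
by exists (c w s); rewrite ?(chart_type chart_c) ?mem_face.
Qed.

Lemma sub_face w T A : (A `<=` face c w T)%fset -> A = face c w (simplex_type tau A).
Proof.
move=> /fsubsetP AT; apply/fsetP => v; apply/idP/imfsetP => [vA|[s /=]].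
  have /imfsetP [s /= sT def_v] := AT v vA; exists s => //=.
  by rewrite inE; apply/mapP; exists v => //; rewrite def_v (chart_type chart_c).
rewrite inE => /mapP [u uA ->] ->; have /imfsetP [s' _ def_u] := AT u uA.
by move: uA; rewrite def_u (chart_type chart_c).
Qed.

Lemma face_closed A B : Y A -> (B `<=` A)%fset -> Y B.
Proof.
move=> /(chart_face chart_c) [w [T ->]] /sub_face ->; exact: face_in.
Qed.

End OneChart.

(** A face has at most one vertex of each type, so a vertex shared with another chart is recognised
    there by its type. *)
Lemma mem_face_eq Y Y' c c' w w' (T : {set S}) s : chart Y c -> chart Y' c' ->
  c w s \in face c' w' T -> c w s = c' w' s.
Proof.
move=> ch ch' /imfsetP [t /= _ e]; rewrite e; congr (c' w' _).
by move/(congr1 tau): e; rewrite (chart_type ch) (chart_type ch').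
Qed.

Hypothesis cox : coxeter_system gen.

Lemma chart_parabolic Y c w w' (I : {set S}) : chart Y c ->
  (forall s, s \notin I -> c w s = c w' s) <-> parabolic gen I (w^-1 * w').
Proof.
move=> ch; rewrite (parabolic_bigcap cox).
by split=> h s /h; rewrite (chart_eq ch).
Qed.

Lemma chart_gen Y c w s t : chart Y c -> t != s -> c (w * gen s) t = c w t.
Proof.
move=> ch ts; apply/esym/(chart_eq ch); rewrite mulKg.
by apply: parabolic_gen; rewrite !inE eq_sym.
Qed.

Lemma chart_gen_neq Y c w s : chart Y c -> c (w * gen s) s <> c w s.
Proof.
move=> ch /esym/(chart_eq ch); rewrite mulKg => /(parabolic_genE cox).
by rewrite !inE eqxx.
Qed.

(* Adjacent chambers share all vertices but one, and in an apartment a panel lies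
   in just two chambers: so the image of the chamber w under an isomorphism
   determines the images of its neighbours. *)
Lemma chart_rigid Y Y' c c' phi : chart Y c -> chart Y' c' ->
  complex_iso phi Y Y' -> (forall s, phi (c 1 s) = c' 1 s) ->
  forall w s, phi (c w s) = c' w s.
Proof.
move=> ch ch' [phi_inj phi_im] phi1 w; have [a <-] := wordP cox w.
elim/last_ind: a => [|a t IH] s; first by rewrite word_nil.
rewrite -cats1 word_cat word1; move: (word gen a) IH => {}w IH.
have inj w1 s1 w2 s2 : phi (c w1 s1) = phi (c w2 s2) -> c w1 s1 = c w2 s2.
  by apply: phi_inj; apply: mem_set; apply: chart_vertex ch _ _.
have off r : r != t -> phi (c (w * gen t) r) = c' w r.
  by move=> rt; rewrite (chart_gen _ ch rt) IH.
have [st|/[dup] st /off ->] := eqVneq s t; last by rewrite (chart_gen _ ch').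
(* Only the vertex of type [t] is left. The image of the whole chamber is a face of some [w'], which
   agrees with [w] off [t] and so is [w] or [w * gen t]. *)
subst s; have : Y' [fset phi v | v in face c (w * gen t) [set: S]%SET]%fset.
  by rewrite -phi_im; exists (face c (w * gen t) [set: S]%SET) => //; apply: face_in ch _ _.
case/(chart_face ch')=> w' [T def_im].
have im r : phi (c (w * gen t) r) \in face c' w' T.
  by rewrite -def_im; apply/imfsetP; exists (c (w * gen t) r); rewrite //= mem_face.
have : parabolic gen [set t]%SET (w^-1 * w').
  apply/(chart_parabolic _ _ _ ch') => r; rewrite inE => rt.
  by apply: (mem_face_eq ch' ch' (T := T)); rewrite -off.
(* [phi] is not known to preserve types: the type [r] of the image is found through injectivity. *)
have /imfsetP [r /= rT def_r] := im t.
case/parabolic_set1 => // ww'; last first.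
  have def_w' : w' = w * gen t by rewrite -ww' mulVKg.
  have [rt|rt] := eqVneq r t; first by rewrite def_r def_w' rt.
  move: def_r; rewrite def_w' (chart_gen _ ch' rt) -IH => /inj /(chart_inj ch) tr.
  by rewrite tr eqxx in rt.
(* If [w' = w], injectivity would identify the vertices of type [t] of two adjacent chambers. *)
have def_w' : w' = w by rewrite -[w]mulg1 -ww' mulVKg.
move: def_r; rewrite def_w' -IH => /inj /[dup] /(chart_inj ch) <-.
by move/(chart_gen_neq ch).
Qed.

End Charts.

(** * The Weyl distance *)

Section Buildings.
Local Open Scope group_scope.
Variables (W : groupType) (S : finType) (gen : S -> W).
Variables (V : choiceType) (X : set {fset V}) (tau : V -> S).
Variable (apts : set (set {fset V})).
Hypothesis cox : coxeter_system gen.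
Hypothesis aptX : apartment_system gen X tau apts.

Notation cface c w := (face c w [set: S]%SET).
Notation cotype := (cotype tau).
Notation parabolic := (parabolic gen).

Lemma apt_chart Y : apts Y -> exists c, chart gen tau Y c.
Proof.
move=> /(apt_coxeter aptX) [f [f_iso f_type]].
by exists (fun w s => f (coxeter_vertex gen w s)); apply: complex_iso_chart.
Qed.

(** A simplex containing it may lie in another apartment, but there too it has at most one vertex of
    each type, so nothing can be added. *)
Lemma face_chamber Y c w : apts Y -> chart gen tau Y c -> chamber X (cface c w).
Proof.
move=> aY ch; split=> [|B XB /fsubsetP sub]; first by apply: (apt_sub aptX aY); apply: face_in ch _ _.
have [Y' aY' Y'B] := apt_cover aptX XB; have [c' ch'] := apt_chart aY'.
move/(chart_face ch'): Y'B => [w' [T def_B]].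
apply/fsetP => v; apply/idP/idP => [|/sub //].
rewrite def_B => /imfsetP [s /= sT ->].
rewrite -(@mem_face_eq _ _ gen _ tau Y Y' c c' w w' T) ?mem_face //.
by rewrite -def_B sub ?mem_face.
Qed.

Lemma chamber_face Y c C : apts Y -> chart gen tau Y c -> chamber X C -> Y C ->
  exists w, C = cface c w.
Proof.
move=> aY ch [_ maxC] /(chart_face ch) [w [T def_C]]; exists w.
apply/esym/maxC; first by have [] := face_chamber w aY ch.
by rewrite def_C; apply/fsubsetP => _ /imfsetP [s /= _ ->]; rewrite mem_face.
Qed.

(** The Weyl distance as a relation, read in any chart based at [C]; [dist_fun] makes it functional
    and [dist_delta] identifies it with [delta]. *)
Definition dist (C D : {fset V}) (w : W) : Prop :=
  exists Y c, [/\ apts Y, chart gen tau Y c, C = cface c 1 & D = cface c w].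

Lemma dist_exists C D : chamber X C -> chamber X D -> exists w, dist C D w.
Proof.
move=> chC chD; case: (chC) (chD) => [XC _] [XD _].
have [Y [aY YC YD]] := apt_common aptX XC XD; have [c ch] := apt_chart aY.
have [g def_C] := chamber_face aY ch chC YC.
have [h def_D] := chamber_face aY ch chD YD.
exists (g^-1 * h), Y, (fun w => c (g * w)).
split=> //; first exact: chart_shift.
  by rewrite def_C /face mulg1.
by rewrite def_D /face mulVKg.
Qed.

(** The apartment isomorphism fixing [C] and [P] matches the two charts at the label 1, hence
    everywhere by rigidity. *)
Lemma dist_fixes Y Y' c c' C D w' P : apts Y -> apts Y' ->
  chart gen tau Y c -> chart gen tau Y' c' -> C = cface c 1 -> C = cface c' 1 ->
  D = cface c' w' -> Y P -> Y' P ->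
  exists phi : V -> V, [/\ forall w s, phi (c w s) = c' w s & {in P, forall v, phi v = v}].
Proof.
move=> aY aY' ch ch' def_C def_C' def_D YP Y'P.
have YC : Y C by rewrite def_C; apply: face_in ch _ _.
have Y'C : Y' C by rewrite def_C'; apply: face_in ch' _ _.
have [phi [phi_iso phi_id]] := apt_iso aptX aY aY' YC YP Y'C Y'P.
exists phi; split=> [|v vP]; last by rewrite phi_id // inE vP orbT.
apply: (chart_rigid cox ch ch' phi_iso) => s.
have sC : c 1 s \in C by rewrite def_C mem_face.
rewrite phi_id ?inE ?sC //.
by apply: (mem_face_eq ch ch' (T := [set: S]%SET)); rewrite -def_C'.
Qed.

(** The isomorphism fixing [C] and [A] carries the chamber [w] of the first chart to the chamber [w]
    of the second, where it must share the vertices of [A] with the chamber [w']. *)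
Lemma dist_parabolic C D D' A w w' : dist C D w -> dist C D' w' ->
  (A `<=` D)%fset -> (A `<=` D')%fset -> parabolic (cotype A) (w^-1 * w').
Proof.
move=> [Y [c [aY ch def_C def_D]]] [Y' [c' [aY' ch' def_C' def_D']]] AD AD'.
have YA : Y A by apply: (face_closed ch) AD; rewrite def_D; apply: face_in ch _ _.
have Y'A : Y' A by apply: (face_closed ch') AD'; rewrite def_D'; apply: face_in ch' _ _.
have [phi [phiE phi_id]] := dist_fixes aY aY' ch ch' def_C def_C' def_D' YA Y'A.
apply/(chart_parabolic cox _ _ _ ch') => s; rewrite inE negbK inE => /mapP [v vA def_s].
have def_v : v = c w s.
  have /imfsetP [t _ def_v] : v \in cface c w by rewrite -def_D (fsubsetP AD).
  by rewrite def_s def_v (chart_type ch).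
rewrite -phiE -def_v (phi_id _ vA) def_v.
apply: (mem_face_eq ch ch' (T := [set: S]%SET)).
by rewrite -def_v -def_D' (fsubsetP AD').
Qed.

Lemma dist_sub C D A w : dist C D w -> (A `<=` C)%fset ->
  (A `<=` D)%fset <-> parabolic (cotype A) w.
Proof.
move=> [Y [c [aY ch def_C def_D]]]; rewrite def_C => /(sub_face ch) def_A.
have -> : parabolic (cotype A) w = parabolic (cotype A) (1^-1 * w) by rewrite invg1 mul1g.
rewrite -(chart_parabolic cox 1 w (cotype A) ch) def_D {1}def_A; split.
  move=> /fsubsetP AD s; rewrite inE negbK => sA.
  by apply: (mem_face_eq ch ch (T := [set: S]%SET)); rewrite AD ?mem_face.
move=> h; apply/fsubsetP => _ /imfsetP [s /= sA ->].
by rewrite h ?mem_face // inE negbK.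
Qed.

(** Taking [A] to be [D] in [dist_parabolic] leaves the parabolic of the empty set. *)
Lemma dist_fun C D w w' : dist C D w -> dist C D w' -> w = w'.
Proof.
move=> dw dw'; have D0 : cotype D = finset.set0.
  have [Y [c [aY ch _ ->]]] := dw.
  by rewrite /cotype (simplex_type_face ch) finset.setCT.
have := dist_parabolic dw dw' (fsubset_refl D) (fsubset_refl D).
by rewrite D0 => /(parabolic0 cox) e; rewrite -[w]mulg1 -e mulVKg.
Qed.

Lemma dist_chamber C D w : dist C D w -> chamber X C /\ chamber X D.
Proof. by case=> Y [c [aY ch -> ->]]; split; apply: face_chamber aY ch. Qed.

Lemma dist1 C D : dist C D 1 -> C = D.
Proof. by case=> Y [c [_ _ -> ->]]. Qed.

Lemma dist_refl C : chamber X C -> dist C C 1.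
Proof.
move=> chC; have [w [Y [c [aY ch def_C _]]]] := dist_exists chC chC.
by exists Y, c.
Qed.

Lemma dist_sym C D w : dist C D w -> dist D C w^-1.
Proof.
move=> [Y [c [aY ch def_C def_D]]]; exists Y, (fun w' => c (w * w')).
split=> //; first exact: chart_shift.
  by rewrite /face mulg1.
by rewrite /face mulgV.
Qed.

Lemma dist_step C D w g : dist C D w -> exists2 D', dist D D' g & dist C D' (w * g).
Proof.
move=> [Y [c [aY ch def_C def_D]]]; exists (cface c (w * g)); last by exists Y, c.
exists Y, (fun w' => c (w * w')); split=> //; first exact: chart_shift.
by rewrite /face mulg1.
Qed.

Lemma dist_face C D w (I : {set S}) : dist C D w -> exists A,
  [/\ X A, cotype A = I & (A `<=` C)%fset].
Proof.
move=> [Y [c [aY ch def_C _]]]; exists (face c 1 (~: I)%SET); split.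
- by apply: (apt_sub aptX aY); apply: face_in ch _ _.
- by rewrite /cotype (simplex_type_face ch) finset.setCK.
by rewrite def_C; apply/fsubsetP => _ /imfsetP [s /= _ ->]; rewrite mem_face.
Qed.

Lemma chamber_exists A : X A -> exists C, chamber X C.
Proof.
move=> XA; have [Y aY _] := apt_cover aptX XA; have [c ch] := apt_chart aY.
by exists (cface c 1); apply: face_chamber aY ch.
Qed.

(** * Adjacency, galleries and agreement with [delta] *)

Lemma adjacentP s C D : chamber X C -> adjacent X tau s C D <-> dist C D (gen s).
Proof.
move=> chC; split=> [[CD [P [[XP cotP] [_ PC] [chD PD]]]]|CD].
  have [w CDw] := dist_exists chC chD.
  have /(dist_sub CDw PC) := PD; rewrite cotP => /(parabolic_set1 cox) [] def_w.
    by case: CD; apply: dist1; rewrite -def_w.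
  by rewrite -def_w.
have [_ chD] := dist_chamber CD; split=> [eCD|].
  apply: (@gen_neq1 _ _ _ cox s); apply: dist_fun CD _; rewrite eCD; exact: dist_refl.
have [P [XP cotP PC]] := dist_face [set s]%SET CD; exists P; split=> //.
split=> //; apply/(dist_sub CD PC); rewrite cotP; apply: parabolic_gen.
by rewrite inE.
Qed.

Lemma dist_adjacent C D D' s w : dist C D w -> dist D D' (gen s) ->
  dist C D' w \/ dist C D' (w * gen s).
Proof.
move=> CD DD'; have [chC chD] := dist_chamber CD; have [_ chD'] := dist_chamber DD'.
have [w' CD'] := dist_exists chC chD'.
have [P [XP cotP PD]] := dist_face [set s]%SET DD'.
have PD' : (P `<=` D')%fset.
  by apply/(dist_sub DD' PD); rewrite cotP; apply: parabolic_gen; rewrite inE.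
have := dist_parabolic CD CD' PD PD'; rewrite cotP => /(parabolic_set1 cox) [] e.
  by left; rewrite -[w]mulg1 -e mulVKg.
by right; rewrite -e mulVKg.
Qed.

(** Each step multiplies the distance by its letter or leaves it unchanged; in the latter case the
    letter is dropped. *)
Lemma gallery_dist C D a : chamber X C -> gallery X tau C a D ->
  exists2 b, subseq b a & dist C D (word gen b).
Proof.
elim: a C => /= [|s a IH] C chC.
  by move=> <-; exists [::]; rewrite ?word_nil; last exact: dist_refl.
case=> E /(adjacentP _ _ chC) CE; have [_ chE] := dist_chamber CE.
case/(IH _ chE)=> b sub_b /dist_sym DE.
have [/dist_sym | /dist_sym] : dist D C (word gen b)^-1 \/ dist D C ((word gen b)^-1 * gen s).
- by apply: dist_adjacent DE _; rewrite -(genV cox); apply: dist_sym.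
- by rewrite invgK => CD; exists b => //; apply: (subseq_trans sub_b (subseq_cons _ _)).
rewrite invgM invgK (genV cox) => CD; exists (s :: b); first by rewrite /= eqxx.
by rewrite word_cons.
Qed.

Lemma dist_gallery C D a : dist C D (word gen a) -> gallery X tau C a D.
Proof.
elim: a C => /= [|s a IH] C; first by rewrite word_nil => /dist1.
move=> CD; have [chC _] := dist_chamber CD; have := dist_sym CD.
rewrite word_cons => /(dist_step (gen s)) [E CE DE].
exists E; first exact/adjacentP.
apply: IH; move: DE; rewrite invgM (genV cox) -mulgA (genK cox) mulg1 => /dist_sym.
by rewrite invgK.
Qed.

(** A reduced word of [w] labels a gallery. Conversely the type of a minimal gallery has a subword
    with value [w], which cannot be shorter than a reduced word and so is the whole type. *)
Lemma dist_delta C D w : dist C D w -> delta gen X tau C D = w.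
Proof.
move=> CD; have [chC _] := dist_chamber CD.
have g0 : gallery X tau C (redword gen w) D by apply: dist_gallery; rewrite word_redword.
have lew a : gallery X tau C a D -> size (redword gen w) <= size a.
  case/(gallery_dist chC) => b sub_b /(dist_fun CD) def_w.
  rewrite (leq_trans _ (size_subseq sub_b)) // def_w; exact: ell_word_le.
apply: xget_unique => [|_ [a [/[dup] ga /(gallery_dist chC) [b sub_b CDb] mina] <-]].
  by exists (redword gen w); [split | rewrite word_redword].
have def_w := dist_fun CD CDb; rewrite def_w; congr (word gen _).
apply/esym/subseq_size_eq => //; apply: leq_trans (mina _ g0) _.
rewrite def_w; exact: ell_word_le.
Qed.

Lemma dist_stepl C D w g :
  dist C D w -> exists2 C', dist C C' g & dist C' D (g^-1 * w).
Proof.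
move=> /dist_sym /(dist_step g) [C' CC' /dist_sym C'D]; exists C' => //.
by rewrite invgM invgK in C'D.
Qed.

Lemma dist_gen_sym C D s : dist C D (gen s) -> dist D C (gen s).
Proof. by rewrite -{2}(genV cox); apply: dist_sym. Qed.

(** Induction on the length of [w], removing the first letter [t] of a reduced word at the end of
    [C]. *)
Lemma dist_adjacent_lt C D D' s w : ell gen w < ell gen (w * gen s) ->
  dist C D w -> dist D D' (gen s) -> dist C D' (w * gen s).
Proof.
have [n] := ubnP (ell gen w); elim: n C w => // n IH C w; rewrite ltnS => le_n lt_ws CD DD'.
have [CD'|//] := dist_adjacent CD DD'; exfalso.
have DD'1 : D = D' -> False.
  move=> eD; apply: (@gen_neq1 _ _ _ cox s); apply: dist_fun DD' _; rewrite eD.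
  by apply: dist_refl; case: (dist_chamber CD').
case def_w: (redword gen w) => [|t a].
  move: def_w CD CD' => /(congr1 (word gen)); rewrite word_redword // word_nil => ->.
  by move=> /dist1 eD /dist1 eD'; apply: DD'1; rewrite -eD.
have red_ta : reduced gen (t :: a) by rewrite -def_w; apply: reduced_redword.
have wE : w = gen t * word gen a by rewrite -word_cons -def_w word_redword.
have ellw : ell gen w = (ell gen (word gen a)).+1.
  by rewrite (ell_word cox (reduced_cons red_ta)) -{1}[w](word_redword cox) def_w ell_word.
have [C1 CC1 C1D] := dist_stepl (gen t) CD.
rewrite wE mulKg in C1D; move: (word gen a) wE ellw C1D => w' wE ellw C1D.
have lt_w's : ell gen w' < ell gen (w' * gen s).
  rewrite -ltnS -ellw (leq_trans lt_ws) // wE -mulgA.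
  by rewrite (leq_trans (ellM_le _ _ _)) // -add1n leq_add2r ell_gen_le.
have C1D' : dist C1 D' (w' * gen s) by apply: IH C1D DD' => //; rewrite -ellw.
(* Back across [t], the distance from [C] to [D'] is [w' s] or [t w' s = w s]. Neither can be [w]:
   the first would make [w s] equal to the shorter [w']. *)
have [|] := dist_adjacent (dist_sym C1D') (dist_gen_sym CC1).
  move/dist_sym; rewrite invgK => /(dist_fun CD') e.
  by move: lt_ws; rewrite {2}e -mulgA (genK cox) mulg1 ellw ltnNge leqnSn.
move/dist_sym; rewrite invgM invgK (genV cox) mulgA -wE => /(dist_fun CD') e.
by move: lt_ws; rewrite -e ltnn.
Qed.

(** Otherwise [D'] and [D''] are [s]-adjacent, and the step between them would lengthen the distance
    from [w s] to [w]. *)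
Lemma dist_adjacent_gt C D D' D'' s w : ell gen (w * gen s) < ell gen w ->
  dist D D' (gen s) -> dist D D'' (gen s) ->
  dist C D' (w * gen s) -> dist C D'' (w * gen s) -> D' = D''.
Proof.
move=> gt_ws DD' DD'' CD' CD''; have [] := dist_adjacent (dist_gen_sym DD') DD''; last first.
  by rewrite genK // => /dist1.
move=> D'D''; have := dist_adjacent_lt _ CD' D'D''; rewrite -mulgA (genK cox) mulg1.
move=> /(_ gt_ws) /(dist_fun CD'') e; by rewrite e ltnn in gt_ws.
Qed.

Lemma sphere_dist C D x : chamber X C -> sphere gen X tau x C D <-> dist C D x.
Proof.
move=> chC; split=> [[chD <-]|CD].
  by have [w /[dup] CD /dist_delta ->] := dist_exists chC chD.
by split; [case: (dist_chamber CD) | apply: dist_delta].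
Qed.

(** The letter is split off at the end of [C], so [dist_adjacent_lt] is applied from the far chamber
    [E] to inverses. *)
Lemma sphere_genM s w C : ell gen w < ell gen (gen s * w) ->
  dist C ^~ (gen s * w) = \bigcup_(D in dist C ^~ (gen s)) dist D ^~ w.
Proof.
move=> lt_sw; apply/seteqP; split=> [E CE|E [D CD DE]].
  by have [D CD] := dist_stepl (gen s) CE; rewrite mulKg => DE; exists D.
have := dist_adjacent_lt _ (dist_sym DE) (dist_gen_sym CD).
have -> : w^-1 * gen s = (gen s * w)^-1 by rewrite invgM (genV cox).
by rewrite !(ellV cox) => /(_ lt_sw) /dist_sym; rewrite invgK.
Qed.

(** Seen from a common chamber [E], both neighbours of [C] realise the shorter distance [w^-1],
    which only one can do. *)
Lemma trivIset_sphere s w C : ell gen w < ell gen (gen s * w) ->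
  trivIset (dist C ^~ (gen s)) (fun D => dist D ^~ w).
Proof.
move=> lt_sw D D' CD CD' [E [/dist_sym DE /dist_sym D'E]].
have e : (gen s * w)^-1 * gen s = w^-1 by rewrite invgM (genV cox) -mulgA (genK cox) mulg1.
by apply: (@dist_adjacent_gt E C D D' s (gen s * w)^-1); rewrite ?e ?(ellV cox).
Qed.

Lemma chambers_of_dist A C : chamber X C -> (A `<=` C)%fset ->
  chambers_of X A = \bigcup_(w in parabolic (cotype A)) dist C ^~ w.
Proof.
move=> chC sAC; apply/seteqP; split=> [D [chD AD]|D [w Aw CD]].
  by have [w CD] := dist_exists chC chD; exists w => //; apply/(dist_sub CD sAC).
by split; [case: (dist_chamber CD) | apply/(dist_sub CD sAC)].
Qed.

(** * Spheres and structure constants *)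

Section Regular.
Variable q : S -> nat.
Hypothesis Xq : regular X tau q.

Lemma card_adjacent C s : chamber X C -> dist C ^~ (gen s) #= `I_(q s).
Proof.
move=> chC; have [P [XP cotP PC]] := dist_face [set s]%SET (dist_refl chC).
have /card_fset_setP [fin card] := Xq (conj XP cotP).
have -> : dist C ^~ (gen s) = chambers_of X P `\ C.
  rewrite (chambers_of_dist chC PC) cotP; apply/seteqP; split=> D /=.
    move=> CD; split; first by exists (gen s) => //; apply: parabolic_gen; rewrite inE.
    move=> eD; apply: (@gen_neq1 _ _ _ cox s); apply: dist_fun CD _.
    by rewrite eD; apply: dist_refl.
  by move=> [[w /(parabolic_set1 cox) [|] -> // /dist1 ->]].
apply/card_fset_setP; split; first exact: finite_setD.
rewrite fset_setD1 //; apply/eqP; rewrite -eqSS -card (cardfsD1 C (fset_set _)) in_fset_set //.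
by rewrite mem_set.
Qed.

Lemma card_sphere a C : chamber X C -> reduced gen a ->
  dist C ^~ (word gen a) #= `I_(\prod_(s <- a) q s)%N.
Proof.
elim: a C => [|s a IH] C chC red_a.
  rewrite big_nil word_nil (_ : dist C ^~ 1 = [set C]) ?card_set1 //.
  by apply/seteqP; split=> [D /dist1 | _ ->] //=; apply: dist_refl.
have red_a' := reduced_cons red_a.
have lt_a : ell gen (word gen a) < ell gen (gen s * word gen a).
  by rewrite -word_cons !ell_word.
rewrite word_cons big_cons sphere_genM //; apply: card_bigcup_const; last exact: trivIset_sphere.
  exact: card_adjacent.
by move=> D CD; apply: IH => //; case: (dist_chamber CD).
Qed.

Lemma card_chambers_of A C : chamber X C -> (A `<=` C)%fset ->
  spherical gen (cotype A) -> chambers_of X A #= `I_(Npar gen q (cotype A)).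
Proof.
move=> chC sAC fin; rewrite (chambers_of_dist chC sAC) /Npar fsbig_finite //=.
apply: (card_bigcup fin) => [w _|w w' _ _ [D [CD CD']]]; last exact: dist_fun CD CD'.
by rewrite -{1}[w](word_redword cox); apply: card_sphere => //; apply: reduced_redword.
Qed.

(** Induction on [a] for all [z]: the sphere around [D] splits into smaller ones around its
    [s]-neighbours, whose distances from [C] are [z] or [z s]. *)
Lemma card_sphereI a x z : reduced gen a -> exists n, forall C D, dist C D z ->
  dist C ^~ x `&` dist D ^~ (word gen a) #= `I_n.
Proof.
elim: a x z => [|s a IH] x z red_a.
  (* The boolean stands for 0 or 1. *)
  exists (x == z) => C D CD.
  have chD : chamber X D by case: (dist_chamber CD).
  have [->|/eqP xz] := eqVneq x z.
    rewrite (_ : _ `&` _ = [set D]) ?card_set1 // word_nil.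
    apply/seteqP; split=> [E [_ /dist1] | _ ->] //=; split=> //; exact: dist_refl.
  rewrite (_ : _ `&` _ = set0) ?II0 ?card_eq00 // word_nil.
  apply/seteqP; split=> // E [CE /dist1 eD]; apply: xz.
  by apply: dist_fun CE _; rewrite -eD.
have red_a' := reduced_cons red_a.
have lt_a : ell gen (word gen a) < ell gen (gen s * word gen a).
  by rewrite -word_cons !ell_word.
have [n1 card1] := IH x (z * gen s) red_a'; have [n2 card2] := IH x z red_a'.
(* If [z s] is longer, all [q s] neighbours are at distance [z s]. Otherwise exactly one is, and the
   other [q s - 1] stay at distance [z]. *)
exists (if ell gen z < ell gen (z * gen s) then q s * n1 else n1 + (q s).-1 * n2)%N => C D CD.
have chD : chamber X D by case: (dist_chamber CD).
have trivD : trivIset (dist D ^~ (gen s))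
    (fun E => dist C ^~ x `&` dist E ^~ (word gen a)).
  by move=> E E' DE DE' [F [[_ EF] [_ E'F]]]; apply: (trivIset_sphere lt_a DE DE'); exists F.
have := card_adjacent s chD.
rewrite word_cons sphere_genM // setI_bigcupr; case: ifP => [lt_z|].
  move/card_bigcup_const; apply=> // E DE; apply: card1.
  exact: dist_adjacent_lt CD DE.
move/negbT; rewrite -leqNgt leq_eqVlt (negPf (ell_gen_neq cox _ _)) /= => gt_z.
move=> /card_fset_setP [fin card]; have [E0 DE0 CE0] := dist_step (gen s) CD.
pose n E := if E == E0 then n1 else n2.
have -> : (n1 + (q s).-1 * n2 = \sum_(E <- fset_set (dist D ^~ (gen s))) n E)%N.
  rewrite (big_fsetD1 E0) /= ?in_fset_set ?mem_set // {1}/n eqxx; congr (_ + _).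
  rewrite big_seq (eq_bigr (fun=> n2)) => [|E]; last first.
    by rewrite !inE /n => /andP[/negPf ->].
  rewrite -big_seq big_const_seq count_predT iter_addn_0 [RHS]mulnC; congr (_ * _)%N.
  by rewrite -card (cardfsD1 E0 (fset_set _)) in_fset_set // mem_set.
apply: card_bigcup fin _ trivD => E DE; rewrite /n; case: eqP => [->|neE]; first exact: card1.
apply: card2; have [//|CE] := dist_adjacent CD DE; case: neE.
exact: dist_adjacent_gt gt_z DE DE0 CE CE0.
Qed.

(** [card_sphereI] provides a candidate, so [xget] does not fall back on its default. *)
Lemma structure_constP a b x y z : dist a b z ->
  dist a ^~ x `&` dist b ^~ y #= `I_(structure_const gen X tau x y z).
Proof.
move=> ab; have [n card_n] := card_sphereI x z (@reduced_redword _ _ _ cox y).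
have sphereE c w : chamber X c -> sphere gen X tau w c = dist c ^~ w.
  by move=> chc; apply/seteqP; split=> d /(sphere_dist _ _ chc).
have [cha chb] := dist_chamber ab; rewrite -!sphereE // /structure_const.
apply: (@xgetPex _ 0%N [set n : nat | forall a b, chamber X a -> chamber X b ->
  delta gen X tau a b = z -> sphere gen X tau x a `&` sphere gen X tau y b #= `I_n]) => //.
  exists n => c d chc chd cd; rewrite !sphereE // -(word_redword cox y); apply: card_n.
  by have [w /[dup] /dist_delta <-] := dist_exists chc chd; rewrite cd.
exact: dist_delta.
Qed.

(** * Simplices and residues *)

(** Steps inside the two residues reach the whole double coset. Conversely [dist_parabolic] is used
    once at each end, replacing [d] by [E] and then [a] by [C]. *)
Lemma residue_dist A D a d y z : dist a d z -> (A `<=` a)%fset -> (D `<=` d)%fset ->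
  dcoset gen (cotype A) z (cotype D) y <->
  exists C E, [/\ (A `<=` C)%fset, (D `<=` E)%fset & dist C E y].
Proof.
move=> ad sAa sDd; split=> [[g Ag [h Dh <-]]|[C [E [sAC sDE CE]]]].
  have [E dE aE] := dist_step h ad; have [C aC CE] := dist_stepl g^-1 aE.
  exists C, E; split.
  - by apply/(dist_sub aC sAa); apply: parabolicV.
  - exact/(dist_sub dE sDd).
  by rewrite invgK mulgA in CE.
have [[cha _] [_ chE]] := (dist_chamber ad, dist_chamber CE).
have [y' aE] := dist_exists cha chE.
exists (y * y'^-1).
  rewrite -[y](invgK y) -invgM; apply: parabolicV; rewrite -{1}[y'](invgK y').
  exact: dist_parabolic (dist_sym aE) (dist_sym CE) sAa sAC.
exists (z^-1 * y'); first exact: dist_parabolic ad aE sDd sDE.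
by rewrite !mulgA mulgK mulgVK.
Qed.

Lemma residue_delta A D a d z : dist a d z -> (A `<=` a)%fset -> (D `<=` d)%fset ->
  [set delta gen X tau C E | C in chambers_of X A & E in chambers_of X D] =
  dcoset gen (cotype A) z (cotype D).
Proof.
move=> ad sAa sDd; apply/seteqP; split=> y.
  move=> [C [chC sAC] [E [chE sDE] <-]]; apply/(residue_dist _ ad sAa sDd).
  by exists C, E; split=> //; have [w /[dup] /dist_delta ->] := dist_exists chC chE.
case/(residue_dist _ ad sAa sDd)=> C [E [sAC sDE CE]].
have [chC chE] := dist_chamber CE.
by exists C; first split; last exists E; rewrite ?(dist_delta CE).
Qed.

(** The double coset has exactly one minimal element, so [xget] has a single candidate. *)
Lemma delta_simplexP A D a d u z : dist a d z -> (A `<=` a)%fset -> (D `<=` d)%fset ->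
  min_reps gen (cotype A) (cotype D) u ->
  delta_simplex gen X tau A D = u <-> dcoset gen (cotype A) u (cotype D) z.
Proof.
move=> ad sAa sDd min_u; rewrite /delta_simplex (residue_delta ad sAa sDd).
have [x zx min_x] := min_reps_exists gen (cotype A) (cotype D) z.
have xE : xget 1 (min_reps gen (cotype A) (cotype D) `&`
    dcoset gen (cotype A) z (cotype D)) = x.
  apply: xget_unique => // y [min_y zy]; apply: min_reps_unique min_x min_y _ => //.
  by rewrite (dcoset_eq zx).
rewrite xE; split=> [<-|uz]; first exact: dcoset_sym.
apply: min_reps_unique min_u min_x _ => //; exact: dcoset_trans uz zx.
Qed.

Lemma simplex_chamber A : X A -> exists2 C, chamber X C & (A `<=` C)%fset.
Proof.
move=> XA; have [Y aY YA] := apt_cover aptX XA; have [c ch] := apt_chart aY.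
move/(chart_face ch): YA => [w [T ->]]; exists (cface c w); first exact: face_chamber aY ch.
by apply/fsubsetP => _ /imfsetP [s /= _ ->]; rewrite mem_face.
Qed.

(** Since a face is recovered from its cotype and the chamber, distinct simplices of one cotype
    share no chamber. *)
Lemma chamber_subset A C : chamber X C -> (A `<=` C)%fset ->
  X A /\ A = [fset v in C | tau v \notin cotype A]%fset.
Proof.
move=> chC sAC; have [w [Y [c [aY ch def_C _]]]] := dist_exists chC chC.
have YC : Y C by rewrite def_C; apply: face_in ch _ _.
split; first by apply: (apt_sub aptX aY); apply: (face_closed ch) sAC.
apply/fsetP => v; rewrite !inE negbK; apply/idP/andP => [vA|[vC]].
  by rewrite (fsubsetP sAC) //; split=> //; apply/mapP; exists v.
case/mapP=> v' v'A; have := fsubsetP sAC _ v'A; move: vC.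
rewrite def_C => /imfsetP [s /= _ ->] /imfsetP [s' /= _ def_v'].
by rewrite def_v' !(chart_type ch) => ->; rewrite -def_v'.
Qed.

(* Double counting of the chambers d with delta(a,d) in W_I u W_J and delta(b,d)
   in W_K v W_J: each simplex of the intersection lies in N(J) of them. *)
Lemma card_FI A B a b z (J : {set S}) u v : spherical gen J ->
  spherical gen (cotype A) -> spherical gen (cotype B) ->
  dist a b z -> (A `<=` a)%fset -> (B `<=` b)%fset ->
  min_reps gen (cotype A) J u -> min_reps gen (cotype B) J v ->
  exists2 n, F_ gen X tau A J u `&` F_ gen X tau B J v #= `I_n &
    (Npar gen q J * n = \sum_(x <- fset_set (dcoset gen (cotype A) u J))
       \sum_(y <- fset_set (dcoset gen (cotype B) v J)) structure_const gen X tau x y z)%N.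
Proof.
move=> finJ finA finB ab sAa sBb min_u min_v.
have [cha chb] := dist_chamber ab.
have fin_dc I w : spherical gen I -> finite_set (dcoset gen I w J).
  move=> finI; exact: finite_image2.
set G := _ `&` _; set n := (\sum_(x <- _) _)%N.
pose E := \bigcup_(x in dcoset gen (cotype A) u J)
  \bigcup_(y in dcoset gen (cotype B) v J) (dist a ^~ x `&` dist b ^~ y).
have cardE : E #= `I_n.
  apply: (card_bigcup (fin_dc _ _ finA)) => [x _|].
    apply: (card_bigcup (fin_dc _ _ finB)) => [y _|]; first exact: structure_constP.
    by move=> y y' _ _ [d [[_ by_] [_ by']]]; apply: dist_fun by_ by'.
  by move=> x x' _ _ [d [[y _ [ax _]] [y' _ [ax' _]]]]; apply: dist_fun ax ax'.
(* The chambers of [E], sorted by distance so far, are now sorted by their face of cotype [J]. *)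
have EG : E = \bigcup_(D in G) chambers_of X D.
  apply/seteqP; split=> d.
    move=> [x ux [y vy [ax by_]]]; have [_ chd] := dist_chamber ax.
    have [D [XD cotD sDd]] := dist_face J (dist_refl chd).
    exists D => //; split; split=> //.
      by apply/(delta_simplexP ax sAa sDd); rewrite cotD.
    by apply/(delta_simplexP by_ sBb sDd); rewrite cotD.
  move=> [D [[[XD cotD] AD] [_ BD]] [chd sDd]].
  have [x ax] := dist_exists cha chd; have [y by_] := dist_exists chb chd.
  exists x; first by rewrite -cotD in min_u *; apply/(delta_simplexP ax sAa sDd).
  by exists y => //; rewrite -cotD in min_v *; apply/(delta_simplexP by_ sBb sDd).
have trivG : trivIset G (chambers_of X).
  move=> D D' [[[_ cotD] _] _] [[[_ cotD'] _] _] [d [[chd sDd] [_ sD'd]]].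
  have [_ ->] := chamber_subset chd sDd; have [_ ->] := chamber_subset chd sD'd.
  by rewrite cotD cotD'.
have cardG D : G D -> chambers_of X D #= `I_(Npar gen q J).
  move=> [[[XD cotD] _] _]; have [C chC sDC] := simplex_chamber XD.
  by rewrite -cotD; apply: card_chambers_of chC sDC _; rewrite cotD.
(* Each simplex of [G] is the cotype-[J] face of a chamber of [E], and [E] is finite. *)
have finG : finite_set G.
  have finE : finite_set E by apply/finite_setP; exists n.
  apply: sub_finite_set (finite_image (fun d : {fset V} => [fset v in d | tau v \notin J]%fset) finE).
  move=> D GD; have [[[XD cotD] _] _] := GD; have [C chC sDC] := simplex_chamber XD.
  exists C; first by rewrite EG; exists D.
  have [_ defD] := chamber_subset chC sDC; by rewrite -cotD -defD.
have /finite_setP [m cardGm] := finG; exists m => //.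
have := card_bigcup_const cardGm cardG trivG; rewrite -EG => cardE'.
by apply/card_eq_II; rewrite mulnC -(card_eql cardE').
Qed.

(** The summand at the identity is an empty product, hence 1 whatever [q] is. *)
Lemma Npar_gt0 (J : {set S}) : spherical gen J -> (0 < Npar gen q J)%N.
Proof.
move=> finJ; rewrite /Npar fsbig_finite //= (big_fsetD1 1) /=; last first.
  by rewrite in_fset_set // mem_set //; apply: parabolic1.
by rewrite q_1.
Qed.

End Regular.
End Buildings.

(** * The intersection numbers and their formula *)

Local Open Scope ring_scope.

Theorem theorem3p1 (W : groupType) (S : finType) (gen : S -> W)
    (V : choiceType) (X : set {fset V}) (tau : V -> S) (q : S -> nat)
    (I J K : {set S}) (u v w : W) :
  coxeter_system gen ->
  building gen X tau ->
  regular X tau q ->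
  spherical gen I -> spherical gen J -> spherical gen K ->
  min_reps gen I J u -> min_reps gen K J v -> min_reps gen I K w ->
  exists c : nat,
    (forall A B, simplices X tau I A -> F_ gen X tau A K w B ->
       F_ gen X tau A J u `&` F_ gen X tau B J v #= `I_c) /\
    (forall z, dcoset gen I w K z ->
       (c%:R : rat) = (Npar gen q J)%:R^-1 *
         (\sum_(x \in dcoset gen I u J) \sum_(y \in dcoset gen K v J)
            ((structure_const gen X tau x y z)%:R : rat))).
Proof.
move=> cox [[X0 _] _ [apts aptX]] Xq finI finJ finK min_u min_v min_w.
pose N z := (\sum_(x <- fset_set (dcoset gen I u J))
  \sum_(y <- fset_set (dcoset gen K v J)) structure_const gen X tau x y z)%N.
(* The count for a fixed pair and a fixed [z]; independence follows by varying one of them at a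
   time. *)
have count A B z : simplices X tau I A -> F_ gen X tau A K w B -> dcoset gen I w K z ->
    exists2 n, F_ gen X tau A J u `&` F_ gen X tau B J v #= `I_n &
      (Npar gen q J * n = N z)%N.
  move=> [XA cotA] [[XB cotB] AB] wz.
  have [a0 cha sAa0] := simplex_chamber aptX XA.
  have [b0 chb sBb0] := simplex_chamber aptX XB.
  have [z0 ab0] := dist_exists aptX cha chb.
  have wz0 : dcoset gen I w K z0.
    by move/(delta_simplexP cox aptX ab0 sAa0 sBb0): AB; rewrite cotA cotB; apply.
  (* Every [z] of the double coset is the distance between some chambers of [A] and [B]. *)
  have [] := residue_dist cox aptX z ab0 sAa0 sBb0; rewrite cotA cotB.
  case; first exact: dcoset_trans (dcoset_sym wz0) wz.
  move=> a [b [sAa sBb ab]] _.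
  have := @card_FI _ _ _ _ _ _ _ cox aptX q Xq A B a b z J u v.
  by rewrite cotA cotB; apply.
(* [c] is read off from one pair at distance [w], built from a chamber; the empty simplex yields an
   apartment and so a chamber. *)
have [C chC] := chamber_exists aptX X0.
have [A0 [B0 [XA0 FB0]]] : exists A B, simplices X tau I A /\ F_ gen X tau A K w B.
  have [D CDw _] := dist_step w (dist_refl aptX chC).
  have [A [XA cotA sAC]] := dist_face aptX I CDw.
  have [B [XB cotB sBD]] := dist_face aptX K (dist_sym CDw).
  exists A, B; split=> //; split=> //.
  apply/(delta_simplexP cox aptX CDw sAC sBD); rewrite cotA cotB //.
  exact: dcoset_refl.
have [c cardc _] := count _ _ _ XA0 FB0 (dcoset_refl gen I w K).
have N_gt0 := Npar_gt0 cox q finJ.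
(* Same pair, varying [z]: the count, hence the sum, stays the same. *)
have Nc z : dcoset gen I w K z -> (Npar gen q J * c = N z)%N.
  move=> wz; have [n cardn <-] := count _ _ _ XA0 FB0 wz.
  by congr (_ * _)%N; apply/card_eq_II; rewrite -(card_eql cardc).
(* Varying pair, same [z = w]: the sum determines the count, as N(J) is positive. *)
exists c; split=> [A B XA FB|z wz].
  have [n cardn /esym] := count _ _ _ XA FB (dcoset_refl gen I w K).
  rewrite -Nc; last exact: dcoset_refl.
  by move/eqP; rewrite eqn_pmul2l // => /eqP ->.
(* Finiteness of the double cosets turns both sums into sums over lists, and the identity in the
   naturals is cast to the rationals. *)
have fin_dc I' u' : spherical gen I' -> finite_set (dcoset gen I' u' J).
  by move=> finI'; exact: finite_image2.
rewrite fsbig_finite; last exact: fin_dc.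
rewrite (eq_bigr (fun x => (\sum_(y <- fset_set (dcoset gen K v J))
  structure_const gen X tau x y z)%:R)) => [|x _]; last first.
  by rewrite fsbig_finite ?GRing.natr_sum //; exact: fin_dc.
rewrite -GRing.natr_sum -/(N z) -Nc // GRing.natrM GRing.mulKf //.
by rewrite Num.Theory.pnatr_eq0 -lt0n.
Qed.
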